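(* Let $X$ be the complete cubical complex of dimension $3$ on a finite linearly ordered vertex set $V$, and let $p>0$ be a constant. Let $g\in C^2(X)$. If $\delta^2g\sim_p\mathbf{1}$, then there are $\theta,\pi\in\mu_2$ and $f\in C^1(X)$ such that $g\sim_{rp}\theta\,[\pi]\cdot\delta^1f$ for a constant $r<1504$.
   Context: $\mu_2=\{1,-1\}$ (multiplicative group). The complete cubical complex of dimension $3$ on $V$ has: $X_0=V$; $X_1$ = unordered pairs of distinct vertices; $X_2$ (squares) = all $4$-element subsets of $V$ endowed, in all possible ways, with the graph structure of a $4$-cycle, $(ijk\ell)$ denoting the square with edges $ij,jk,k\ell,\ell i$; $X_3$ (cubes) = all $8$-element subsets of $V$ endowed, in all possible ways, with the graph structure of $\{0,1\}^3$, each having six square faces. $C^d(X)$ is the group of functions $X_d\to\mu_2$ under pointwise multiplication; $\mathbf{1}$ is the constant function $1$. $(\delta^1f)_{ijk\ell}=f_{ij}f_{jk}f_{k\ell}f_{\ell i}$ for $f\in C^1(X)$, and $(\delta^2g)_c$ is the product of $g$ over the six square faces of the cube $c$, for $g\in C^2(X)$. For $f,f'\in C^d(X)$, $f\sim_pf'$ means $\Pr\{f_x\ne f'_x\}\le p$ for $x\in X_d$ uniformly random. $[+1]\in C^2(X)$ is the constant function $1$, and $[-1]\in C^2(X)$ is defined, with respect to the fixed linear order on $V$, by $[-1]_c=+1$ if the vertices of the square $c$ can be read in increasing order going around $c$ (i.e. $c=(ijk\ell)$ with $i<j<k<\ell$), and $[-1]_c=-1$ otherwise.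
   Formalization: The vertex set V is assumed to have at least nine elements: with at most seven there are no cubes, so the probability in the hypothesis is undefined, and with exactly eight the claim is false for small p. *)

(* Defs.v *)
From mathcomp Require Import all_boot all_order all_algebra.
From mathcomp Require Import reals.

Set Implicit Arguments.
Unset Strict Implicit.
Unset Printing Implicit Defensive.

Import Order.TTheory GRing.Theory Num.Theory.
Local Open Scope ring_scope.

(* The group {1,-1} is taken inside the ring int, so that products of cochain
   values are products in int. *)
Definition mu2 : seq int := [:: 1; -1].

(* C^d(X), for a finite type C of d-cells: the functions C -> mu2. *)
Definition cochain (C : finType) : {pred {ffun C -> int}} := ffun_on mu2.
Arguments cochain C : clear implicits.

Section CompleteCubicalComplex.
Variable V : finType.

Definition edge := {e : {set V} | #|e| == 2%N}.

(* Squares and cubes are graphs without isolated vertices, so they are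
   represented by their edge sets; the vertex set is the union of the edges. *)
Definition cycle4 (i j k l : V) : {set {set V}} :=
  [set [set i; j]; [set j; k]; [set k; l]; [set l; i]].

Definition is_square (E : {set {set V}}) : bool :=
  [exists i, exists j, exists k, exists l,
     uniq [:: i; j; k; l] && (E == cycle4 i j k l)].

Definition square := {E : {set {set V}} | is_square E}.

Definition corner : finType := {ffun 'I_3 -> bool}.

Definition corner_adj (u v : corner) : bool := #|[set a | u a != v a]| == 1%N.

Definition cube_graph (x : {ffun corner -> V}) : {set {set V}} :=
  [set [set x e.1; x e.2] | e : corner * corner & corner_adj e.1 e.2].

(* The part of cube_graph x lying in the facet {u | u a = b} of {0,1}^3. *)
Definition facet_graph (x : {ffun corner -> V}) (a : 'I_3) (b : bool) :
    {set {set V}} :=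
  [set [set x e.1; x e.2] | e : corner * corner &
     [&& corner_adj e.1 e.2, e.1 a == b & e.2 a == b]].

Definition is_cube (E : {set {set V}}) : bool :=
  [exists x : {ffun corner -> V}, injectiveb x && (E == cube_graph x)].

Definition cube := {E : {set {set V}} | is_cube E}.

Definition is_face (q : square) (c : cube) : bool :=
  [exists x : {ffun corner -> V},
     [&& injectiveb x, val c == cube_graph x &
         [exists a, exists b, val q == facet_graph x a b]]].

Definition delta1 (f : {ffun edge -> int}) : {ffun square -> int} :=
  [ffun q : square => \prod_(e : edge | val e \in val q) f e].

Definition delta2 (g : {ffun square -> int}) : {ffun cube -> int} :=
  [ffun c : cube => \prod_(q : square | is_face q c) g q].

End CompleteCubicalComplex.

Definition increasing_square (d : Order.disp_t) (V : finOrderType d)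
    (q : square V) : bool :=
  [exists i, exists j, exists k, exists l,
     [&& (i < j)%O, (j < k)%O, (k < l)%O & val q == cycle4 i j k l]].

(* [pi] for pi in mu2 (only pi = 1 and pi = -1 are meaningful). *)
Definition order_cochain (d : Order.disp_t) (V : finOrderType d) (pi : int) :
    {ffun square V -> int} :=
  [ffun q : square V => if pi == 1 then 1 else if increasing_square q then 1 else -1].

(* Pr {f x <> f' x}, for x uniform in a nonempty finite type C. *)
Definition disagreement (R : realType) (C : finType) (f f' : {ffun C -> int}) :
    R :=
  #|[set x | f x != f' x]|%:R / #|C|%:R.

Definition sim (R : realType) (C : finType) (p : R) (f f' : {ffun C -> int}) :
    bool :=
  disagreement R f f' <= p.

(* Main.v *)
Require Import Defs.
From mathcomp Require Import all_boot all_order all_algebra all_fingroup.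
From mathcomp Require Import primitive_action alt.
From mathcomp Require Import reals.

(* On at least nine vertices a closed 2-cochain g is exactly of the form
   theta [pi] delta f.  Its product over the three squares of a K_{2,3} does not
   depend on the K_{2,3}, since two cubes differing in one corner compare four of
   them; nor does, once these products are 1, its product over the three squares
   of a K_4.  Both products are 1 after multiplying g by a suitable theta [pi],
   and then f_ax = g(axuv) g(uxvw) is a symmetric function of a and x with
   coboundary g.  So theta, pi and f are explicit in the values of g near five
   base vertices.

   If only most cubes are good, move the base by a random permutation s.  For a
   fixed square q, nine vertices contain q and the base, and the formula holds
   at s(q) as soon as all cubes on the images of these nine vertices are good.
   By linear algebra over F_2 it is enough to test 36^2 = 1296 of these cubes,
   because a square is given by its two diagonals and nine vertices have 36
   pairs.  Each tested cube is uniformly distributed, so s(q) fails with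
   probability at most 1296 p; averaging over q yields a good s. *)

Import Order.TTheory GRing.Theory Num.Theory.
Local Open Scope ring_scope.

Set Implicit Arguments.
Unset Strict Implicit.
Unset Printing Implicit Defensive.

(** * Corners of the cube in coordinates *)

Definition corner_of (b0 b1 b2 : bool) : corner :=
  [ffun i : 'I_3 => nth false [:: b0; b1; b2] i].

(** With [s] and [t] the two free coordinates, false-false, true-false, true-true, false-true runs
    around any facet. *)
Definition facet_corner (a : 'I_3) (b s t : bool) : corner :=
  match val a with
  | 0 => corner_of b s t
  | 1 => corner_of s b t
  | _ => corner_of s t b
  end.

Lemma corner_of_eq b0 b1 b2 d0 d1 d2 :
  (corner_of b0 b1 b2 == corner_of d0 d1 d2) = [&& b0 == d0, b1 == d1 & b2 == d2].
Proof.
apply/eqP/and3P=> [/ffunP E|[/eqP-> /eqP-> /eqP-> //]].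
have := (E ord0, E (inord 1), E (inord 2)); rewrite !ffunE !inordK //=.
by case=> [[-> ->] ->].
Qed.

Lemma facet_corner_eq a b s t s' t' :
  (facet_corner a b s t == facet_corner a b s' t') = (s == s') && (t == t').
Proof.
by case: a => [[|[|[|]]] lt_a] //; rewrite /facet_corner /= corner_of_eq eqxx ?andbT.
Qed.

(** Derives disequalities between vertices from the [uniq], [\notin] and [!=] hypotheses, up to
    symmetry. *)
Ltac distinct :=
  repeat match goal with
  | H : is_true (uniq _) |- _ => revert H
  | H : is_true (_ \notin _) |- _ => revert H
  | H : is_true (_ != _) |- _ => revert H
  end;
  rewrite /= ?inE ?negb_or ?andbT;
  repeat match goal with |- is_true _ -> _ => let H := fresh "D" in intro H end;
  repeat match goal with H : is_true (_ && _) |- _ => case/andP: H => ? ? end;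
  repeat (apply/andP; split);
  solve [done | assumption | rewrite eq_sym; assumption].

(** * Closed cochains on squares: sums over copies of K_{2,3} *)

Section Cocycles.
Variable T : finType.
Implicit Types (G : T -> T -> T -> T -> bool).

(** Cochains are written additively here, with values in [bool] under [(+)]. The two symmetries
    generate the dihedral group of the 4-cycle. The value [false] on collapsed squares spares case
    distinctions when vertices coincide. *)
Record square_symmetric G : Prop := SquareSymmetric {
  swap_opposite : forall a x b y, G a x b y = G b x a y;
  transpose_square : forall a x b y, G a x b y = G x a y b;
  collapse_square : forall a x y, G a x a y = false }.

Definition facet_value G (y : corner -> T) (i : 'I_3 * bool) : bool :=
  let v s t := y (facet_corner i.1 i.2 s t) in
  G (v false false) (v true false) (v true true) (v false true).

Definition cube_sum G (y : corner -> T) : bool :=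
  \big[addb/false]_(i : 'I_3 * bool) facet_value G y i.

Definition cube_closed G := forall y : corner -> T, injective y -> cube_sum G y = false.

(** The three 4-cycles of the K_{2,3} with parts {a, b} and {x, y, z}. *)
Definition theta_sum G a b x y z := G a x b y (+) G a y b z (+) G a z b x.

(** The three 4-cycles of the K_4 on a, b, c, d. *)
Definition tetra_sum G a b c d := G a b c d (+) G a c b d (+) G a b d c.

Lemma swap_middle G a x b y : square_symmetric G -> G a x b y = G a y b x.
Proof. by move=> [swp rot _]; rewrite rot swp rot. Qed.

Lemma collapse_middle G a x b : square_symmetric G -> G a x b x = false.
Proof. by move=> [swp rot col]; rewrite rot col. Qed.

Lemma cube_sumE G (y : corner -> T) : cube_sum G y =
  let v b0 b1 b2 := y (corner_of b0 b1 b2) in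
  let: (o, l) := (false, true) in
      G (v o o o) (v o l o) (v o l l) (v o o l)
  (+) G (v l o o) (v l l o) (v l l l) (v l o l)
  (+) G (v o o o) (v l o o) (v l o l) (v o o l)
  (+) G (v o l o) (v l l o) (v l l l) (v o l l)
  (+) G (v o o o) (v l o o) (v l l o) (v o l o)
  (+) G (v o o l) (v l o l) (v l l l) (v o l l).
Proof.
rewrite /cube_sum -(pair_bigA _ (fun a b => facet_value G y (a, b))) /=.
rewrite !big_ord_recl big_ord0 !big_bool /facet_value /facet_corner /=.
by do 6!case: (G _ _ _ _).
Qed.

(** In this cube [u] and [w] are antipodal, with neighbours [x, y, z] and [p, q, r]; the faces at
    [u] are balanced against those at [w]. *)
Lemma cube_closedE G (u x y p z r q w : T) :
  square_symmetric G -> cube_closed G -> uniq [:: u; x; y; p; z; r; q; w] ->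
  G u x p y (+) G u y q z (+) G u z r x = G w p y q (+) G w q z r (+) G w r x p.
Proof.
move=> symG clG uniq_s; set s := [:: _; _; _; _; _; _; _; _] in uniq_s.
(* The list [s] follows the binary code of the corners, from [u] at 000 to [w] at 111. *)
pose code (c : corner) := (c ord0 + 2 * c (inord 1) + 4 * c (inord 2))%N.
pose v c := nth u s (code c).
have code_lt c : (code c < size s)%N.
  by rewrite /code; case: (c _); case: (c _); case: (c _).
have v_inj : injective v.
  move=> c c' /eqP; rewrite nth_uniq // /code => /eqP eq_code.
  apply/ffunP=> i.
  have -> : i = nth ord0 [:: ord0; inord 1; inord 2] i.
    by apply/val_inj; case: i => [[|[|[|]]]] //= ?; rewrite inordK.
  move: eq_code; case: i => [[|[|[|]]]] //= _;
  by do 6!case: (fun_of_fin _ _).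
have codeE b0 b1 b2 : v (corner_of b0 b1 b2) = nth u s (b0 + 2 * b1 + 4 * b2).
  by rewrite /v /code !ffunE !inordK.
have := clG v v_inj; rewrite cube_sumE /= !codeE /=.
have [swp rot _] := symG; have mid := fun a x b y => @swap_middle G a x b y symG.
rewrite (swp x) (mid w p x r) (mid u x r z) (swp y) (swp z) (mid w r z q).
by do 6!case: (G _ _ _ _).
Qed.

Lemma exists_fresh (s : seq T) : (size s < #|T|)%N -> exists z, z \notin s.
Proof.
move=> lt_s; apply/existsP; rewrite -negb_forall; apply/forallP=> s_all.
have: (#|T| <= size s)%N.
  by apply: leq_trans (card_size s); apply/subset_leq_card/subsetP=> z _; apply: s_all.
by rewrite leqNgt lt_s.
Qed.

Hypothesis card_T : (8 < #|T|)%N.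
Variable G : T -> T -> T -> T -> bool.
Hypotheses (symG : square_symmetric G) (clG : cube_closed G).

(* The two cubes on [u; x, y, z; p, q, r; w] and [u; x, y, z; p, q, r; w'] share
   the three faces at [u]. *)
Lemma theta_sum_cubes p q r w w' x y z : uniq [:: p; q; r; w; w'; x; y; z] ->
  theta_sum G w w' p q r =
  theta_sum G p q w w' y (+) theta_sum G q r w w' z (+) theta_sum G r p w w' x.
Proof.
move=> uniq_s; have [u u_new] := @exists_fresh [:: p; q; r; w; w'; x; y; z] card_T.
have cube_w := @cube_closedE G u x y p z r q w symG clG.
have cube_w' := @cube_closedE G u x y p z r q w' symG clG.
have [swp rot _] := symG; have mid := fun a x b y => @swap_middle G a x b y symG.
have {}cube_w := cube_w ltac:(distinct).
have {}cube_w' := cube_w' ltac:(distinct).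
move: cube_w cube_w'; rewrite /theta_sum.
rewrite (rot w p y q) (rot w q z r) (rot w r x p).
rewrite (rot w' p y q) (rot w' q z r) (rot w' r x p).
rewrite (mid p w q y) (mid q w r z) (mid r w p x).
rewrite (rot w p w' q) (rot w q w' r) (rot w r w' p).
by do 12!case: (G _ _ _ _).
Qed.

(** In [theta_sum_cubes] the vertex [y] occurs in a single term. *)
Lemma theta_sum_replace p q w w' y y' :
  uniq [:: p; q; w; w'; y] -> uniq [:: p; q; w; w'; y'] ->
  theta_sum G p q w w' y = theta_sum G p q w w' y'.
Proof.
move=> uniq_y uniq_y'; have [-> //|ne_y] := eqVneq y y'.
have [r r_new] := @exists_fresh [:: p; q; w; w'; y; y'] (ltn_trans (isT : 6 < 8)%N card_T).
have [x x_new] := @exists_fresh [:: p; q; w; w'; y; y'; r] (ltn_trans (isT : 7 < 8)%N card_T).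
have [z z_new] := @exists_fresh [:: p; q; w; w'; y; y'; r; x] card_T.
have := @theta_sum_cubes p q r w w' x y z ltac:(distinct).
rewrite (@theta_sum_cubes p q r w w' x y' z) //; last by distinct.
by do 4!case: (theta_sum _ _ _ _ _ _).
Qed.

Lemma theta_sum_mid p q x y z : theta_sum G p q x y z = theta_sum G p q y x z.
Proof.
have mid a x' b y' := @swap_middle G a x' b y' symG.
rewrite /theta_sum (mid p x q y) (mid p y q z) (mid p z q x).
by do 3!case: (G _ _ _ _).
Qed.

Lemma theta_sum_rot p q x y z : theta_sum G p q x y z = theta_sum G p q y z x.
Proof. by rewrite /theta_sum; do 3!case: (G _ _ _ _). Qed.

(** The triple is exchanged one vertex at a time, passing through a vertex [t] outside both
    triples. *)
Lemma theta_sum_indep p q x y z x' y' z' :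
  uniq [:: p; q; x; y; z] -> uniq [:: p; q; x'; y'; z'] ->
  theta_sum G p q x y z = theta_sum G p q x' y' z'.
Proof.
move=> uniq_s uniq_s'.
have [t t_new] := @exists_fresh [:: p; q; x; y; z; x'; y'; z'] card_T.
have replace := theta_sum_replace.
(* The intermediate triple [y, t, x'] must have distinct entries; if [x' = y], then [x] and [y] are
   interchanged first. *)
wlog ne_x'y : x y uniq_s t_new / x' != y => [wlogH|].
  have [eq_x'y|] := eqVneq x' y; last exact: wlogH.
  rewrite theta_sum_mid; apply: wlogH.
  - by distinct.
  - by distinct.
  - by rewrite eq_x'y; distinct.
rewrite (replace p q x y z t); try by distinct.
rewrite theta_sum_rot (replace p q y t x x'); try by distinct.
rewrite theta_sum_rot (replace p q t x' y y'); try by distinct.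
by rewrite theta_sum_rot; apply: replace; distinct.
Qed.

(** For [p, q, r] off both pairs, [theta_sum_cubes] expresses each side through sums over the pairs
    pq, qr, rp, which no longer depend on their triples. *)
Lemma theta_sum_const a b x y z a' b' x' y' z' :
  uniq [:: a; b; x; y; z] -> uniq [:: a'; b'; x'; y'; z'] ->
  theta_sum G a b x y z = theta_sum G a' b' x' y' z'.
Proof.
move=> uniq_s uniq_s'.
have [p p_new] := @exists_fresh [:: a; b; a'; b'] (ltn_trans (isT : 4 < 8)%N card_T).
have [q q_new] := @exists_fresh [:: a; b; a'; b'; p] (ltn_trans (isT : 5 < 8)%N card_T).
have [r r_new] := @exists_fresh [:: a; b; a'; b'; p; q] (ltn_trans (isT : 6 < 8)%N card_T).
have pair_sum c d : uniq [:: p; q; r; c; d] -> exists u v w,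
    [/\ uniq [:: p; q; r; u; v; w; c; d] &
     theta_sum G c d p q r =
     theta_sum G p q c d v (+) theta_sum G q r c d w (+) theta_sum G r p c d u].
  move=> uniq_cd.
  have [u u_new] := @exists_fresh [:: p; q; r; c; d] (ltn_trans (isT : 5 < 8)%N card_T).
  have [v v_new] := @exists_fresh [:: p; q; r; c; d; u] (ltn_trans (isT : 6 < 8)%N card_T).
  have [w w_new] := @exists_fresh [:: p; q; r; c; d; u; v] (ltn_trans (isT : 7 < 8)%N card_T).
  exists u, v, w; split; first by distinct.
  by apply: theta_sum_cubes; distinct.
rewrite (@theta_sum_indep a b x y z p q r) //; last by distinct.
rewrite (@theta_sum_indep a' b' x' y' z' p q r) //; last by distinct.
have [|u [v [w [uniq1 ->]]]] := pair_sum a b; first by distinct.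
have [|u' [v' [w' [uniq2 ->]]]] := pair_sum a' b'; first by distinct.
rewrite (@theta_sum_indep p q a b v a' b' v'); try by distinct.
rewrite (@theta_sum_indep q r a b w a' b' w'); try by distinct.
by rewrite (@theta_sum_indep r p a b u a' b' u'); try by distinct.
Qed.

End Cocycles.

(** * Integration of cochains whose K_{2,3} and K_4 sums vanish *)

Section Potential.
Variable T : finType.
Variable G : T -> T -> T -> T -> bool.

Definition apex_value u v w x := (x != v) && G u x v w.

(** For symmetric [G] the general formula of the last branch already gives [apex_value] at [a = u]
    and [false] at [x = v]; the earlier branches impose the same values on the reversed edges. *)
Definition oriented_potential u v w a x : bool :=
  if a == u then apex_value u v w x
  else if x == u then apex_value u v w a
  else if (a == v) || (x == v) then false
  else G a x u v (+) apex_value u v w x.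

(** The disjunction forces symmetry for every [G], so that an edge cochain is always defined; it
    changes nothing once [oriented_potential] is symmetric. *)
Definition potential u v w a x : bool :=
  oriented_potential u v w a x || oriented_potential u v w x a.

Lemma potentialC u v w a x : potential u v w a x = potential u v w x a.
Proof. exact: orbC. Qed.

Hypothesis symG : square_symmetric G.
Hypothesis theta0 : forall a b x y z, uniq [:: a; b; x; y; z] -> theta_sum G a b x y z = false.

Let swp := swap_opposite symG.
Let trp := transpose_square symG.
Let mid a x b y : G a x b y = G a y b x := swap_middle a x b y symG.

(** For fixed [a, b] the vanishing sum is a cocycle relation in [x, y, z]. When some of these
    vertices coincide it follows from the values on collapsed squares, so only coincidences of
    [x, y, z] with [a, b] are excluded. *)
Lemma theta_degenerate a b x y z :
  [&& x != a, x != b, y != a, y != b, z != a & z != b] ->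
  G a x b y (+) G a y b z = G a x b z.
Proof.
move=> D; have col := collapse_square symG; have col' a' x' b' := collapse_middle a' x' b' symG.
have [<-|ne_ab] := eqVneq a b; first by rewrite !col.
have [<-|ne_xy] := eqVneq x y; first by rewrite col'.
have [<-|ne_yz] := eqVneq y z; first by rewrite col' addbF.
have [<-|ne_xz] := eqVneq x z; first by rewrite col' (mid a y) addbb.
have := @theta0 a b x y z ltac:(distinct); rewrite /theta_sum (mid a z).
by do 3!case: (G _ _ _ _).
Qed.

(** Exchanging [d] for [d'] changes the three squares by the squares with one diagonal dd' and the
    other ac, ab or bc; these three make up [theta_sum G d d' a b c]. *)
Lemma tetra_sum_replace a b c d d' : uniq [:: a; b; c; d; d'] ->
  tetra_sum G a b c d = tetra_sum G a b c d'.
Proof.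
move=> D; rewrite /tetra_sum.
have := @theta_degenerate a c b d d' ltac:(distinct).
have := @theta_degenerate a b c d d' ltac:(distinct).
have := @theta_degenerate b c a d d' ltac:(distinct).
have := @theta0 d d' a b c ltac:(distinct); rewrite /theta_sum.
rewrite (trp d a) (trp d b) (trp d c) (swp c d) (trp a b d) (trp a b d').
by do 9!case: (G _ _ _ _).
Qed.

(** The pair [u, v] is kept, and the other two vertices are exchanged one at a time through [t]. *)
Lemma tetra_sum_const u v a x w s : (6 < #|T|)%N ->
  uniq [:: u; v; a; x] -> uniq [:: u; v; w; s] ->
  tetra_sum G u v a x = tetra_sum G u v w s.
Proof.
move=> card_T D D'; have [t t_new] := @exists_fresh _ [:: u; v; a; x; w; s] card_T.
have replace b c c' : uniq [:: u; v; b; c] -> uniq [:: u; v; b; c'] ->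
    tetra_sum G u v b c = tetra_sum G u v b c'.
  have [-> //|ne_c] := eqVneq c c'; move=> D1 D2.
  by apply: tetra_sum_replace; distinct.
have tetraC b c : tetra_sum G u v b c = tetra_sum G u v c b.
  by rewrite /tetra_sum (mid u b); do 3!case: (G _ _ _ _).
rewrite (replace a x t) ?(tetraC a); try by distinct.
rewrite (replace t a w) ?(tetraC t); try by distinct.
by apply: replace; distinct.
Qed.

Variables u v w : T.
Hypothesis uniq_base : uniq [:: u; v; w].
Hypothesis tetra0 : forall a x, uniq [:: u; v; a; x] -> tetra_sum G u v a x = false.

Local Notation phi := (apex_value u v w).

(** This is the cocycle relation for the pair [u, v], taken through the base vertex [w]. *)
Lemma apex_valueD a x : [&& a != u, a != v, x != u & x != v] ->
  phi a (+) phi x = G u a v x.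
Proof.
move=> /and4P[au av xu xv]; rewrite /apex_value av xv /=.
by rewrite (mid u x) theta_degenerate //; distinct.
Qed.

(** Away from [u] and [v], the two orientations differ by [G a x u v (+) G x a u v (+) G u a v x],
    which is the K_4 sum at u, v, a, x. *)
Lemma oriented_potentialC a x : a != x ->
  oriented_potential u v w a x = oriented_potential u v w x a.
Proof.
move=> ne_ax; rewrite /oriented_potential.
have [au|au] := eqVneq a u; have [xu|xu] := eqVneq x u => //.
  by rewrite au xu eqxx in ne_ax.
have [av|av] := eqVneq a v; have [xv|xv] := eqVneq x v => //=.
have := @apex_valueD a x ltac:(distinct).
have := @tetra0 a x ltac:(distinct); rewrite /tetra_sum.
rewrite (swp u v a) (mid a v) (swp u v x) (mid x v).
by case: (phi a) (phi x) => [] []; do 3!case: (G _ _ _ _).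
Qed.

Lemma potentialE a x : a != x -> potential u v w a x = oriented_potential u v w a x.
Proof. by move=> ne_ax; rewrite /potential (oriented_potentialC ne_ax) orbb. Qed.

Lemma oriented_potential_coherent a x : [&& a != x, x != u & a != v] ->
  oriented_potential u v w a x = G a x u v (+) phi x.
Proof.
case/and3P=> ne_ax ne_xu ne_av; rewrite /oriented_potential (negPf ne_xu) (negPf ne_av).
have [->|_] := eqVneq a u; first by rewrite collapse_square.
have [->|//] := eqVneq x v.
by rewrite trp collapse_square // /apex_value eqxx.
Qed.

(** All four edges can be oriented from the diagonal [a, b] to [x, y], so that [phi x] and [phi y]
    cancel. The cocycle relations for the pairs xv and yv, and then ab, collect the remaining
    terms. *)
Lemma coherent_square a x b y : uniq [:: a; x; b; y] ->
  [&& x != u, y != u, a != v & b != v] ->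
  G a x b y = potential u v w a x (+) potential u v w x b
              (+) potential u v w b y (+) potential u v w y a.
Proof.
move=> D /and4P[xu yu av bv]; have ne_uv : u != v by distinct.
rewrite (potentialC _ _ _ x) (potentialC _ _ _ y) !potentialE; try by distinct.
rewrite !oriented_potential_coherent; try by distinct.
have := @theta_degenerate x v a u b ltac:(distinct).
have := @theta_degenerate y v a u b ltac:(distinct).
have := @theta_degenerate a b x v y ltac:(distinct).
rewrite (trp a x u v) (trp b x u v) (mid x b) (trp a x b v) (trp a v b y) (swp v a).
rewrite (trp a y u v) (trp b y u v) (mid y b).
by case: (phi x) (phi y) => [] []; do 7!case: (G _ _ _ _).
Qed.

Lemma apex_square a b : uniq [:: u; a; v; b] ->
  G u a v b = potential u v w u a (+) potential u v w a v
              (+) potential u v w v b (+) potential u v w b u.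
Proof.
move=> D; rewrite -(@apex_valueD a b); last by distinct.
rewrite (potentialC _ _ _ b u) !potentialE; try by distinct.
rewrite /oriented_potential !eqxx.
have [-> -> -> ->] : [/\ a == u = false, a == v = false, b == u = false & b == v = false].
  by split; apply/negbTE; distinct.
have -> : (v == u) = false by apply/negbTE; distinct.
by case: (phi a) (phi b) => [] [].
Qed.

(** Unless [u] and [v] are opposite vertices of the square, [coherent_square] applies to one of the
    two orders of its diagonals. If they are opposite, [apex_square] applies. *)
Theorem square_potential a x b y : uniq [:: a; x; b; y] ->
  G a x b y = potential u v w a x (+) potential u v w x b
              (+) potential u v w b y (+) potential u v w y a.
Proof.
move=> D; have ne_uv : u != v by distinct.
have [H|H] := boolP [&& x != u, y != u, a != v & b != v]; first exact: coherent_square.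
have [H'|H'] := boolP [&& a != u, b != u, x != v & y != v].
  rewrite trp (@coherent_square x a y b) //; last by distinct.
  rewrite (potentialC _ _ _ x a) (potentialC _ _ _ a y) (potentialC _ _ _ y b).
  rewrite (potentialC _ _ _ b x).
  by do 4!case: (potential _ _ _ _ _).
have pC := potentialC u v w; move: H H'; rewrite !negb_and !negbK.
case/or4P=> /eqP E1; case/or4P=> /eqP E2;
  try (by case/eqP: ne_uv; rewrite -E1 -E2);
  move: D; rewrite E1 E2 => D;
  try (by rewrite /= !inE ?eqxx ?orbT ?andbF in D).
- rewrite trp apex_square; last by distinct.
  rewrite (pC a u) (pC u b) (pC b v) (pC v a).
  by do 4!case: (potential _ _ _ _ _).
- rewrite trp swp apex_square; last by distinct.
  rewrite (pC a v) (pC v b) (pC b u) (pC u a).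
  by do 4!case: (potential _ _ _ _ _).
- rewrite swp apex_square; last by distinct.
  rewrite (pC v x) (pC x u) (pC u y) (pC y v).
  by do 4!case: (potential _ _ _ _ _).
- exact: apex_square.
Qed.
End Potential.

(** * Splitting off the sign and the order cochain *)

Lemma uniq4_swap (T : eqType) (a x b y : T) : uniq [:: b; x; a; y] = uniq [:: a; x; b; y].
Proof.
apply/perm_uniq/seq.permP=> P /=.
by rewrite addnCA [(P a + _)%N in RHS]addnCA; congr addn; rewrite addnCA.
Qed.

Lemma uniq4_transpose (T : eqType) (a x b y : T) :
  uniq [:: x; a; y; b] = uniq [:: a; x; b; y].
Proof.
by apply/perm_uniq/seq.permP=> P /=; rewrite addnCA; do 2!congr addn; rewrite addnCA.
Qed.

(* Every one of the twelve edges of a cube lies in two facets. *)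
Lemma cube_edge_sum (e1 e2 e3 e4 e5 e6 e7 e8 e9 e10 e11 e12 : bool) :
  (e1 (+) e2 (+) e3 (+) e4) (+) (e5 (+) e6 (+) e7 (+) e8) (+)
  (e9 (+) e6 (+) e3 (+) e10) (+) (e11 (+) e2 (+) e7 (+) e12) (+)
  (e9 (+) e5 (+) e1 (+) e11) (+) (e10 (+) e4 (+) e8 (+) e12) = false.
Proof.
by case: e1; case: e2; case: e3; case: e4; case: e5; case: e6; case: e7; case: e8;
   case: e9; case: e10; case: e11; case: e12.
Qed.

Section Normalization.
Variable T : finType.
Variables (G : T -> T -> T -> T -> bool) (L : rel T).

(* For a linear order [L]: [a] and [b] separate [x] from [y] in the induced
   cyclic order. *)
Definition crossing a x b y := L a x (+) L b x (+) L a y (+) L b y.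

Hypothesis antiL : forall a b, a != b -> L a b = ~~ L b a.

(** All four comparisons are reversed, and four negations cancel. *)
Lemma crossing_transpose a x b y : uniq [:: a; x; b; y] ->
  crossing a x b y = crossing x a y b.
Proof.
move=> D; rewrite /crossing (antiL (_ : a != x)) ?(antiL (_ : a != y)); try by distinct.
rewrite (antiL (_ : b != x)) ?(antiL (_ : b != y)); try by distinct.
by do 4!case: (L _ _).
Qed.

Variables u v w s t : T.

(** Of the three 4-cycles of a K_4 an odd number is crossing, and of a K_{2,3} an even number. Hence
    theta [pi] adds theta to a K_4 sum and theta + pi to a K_{2,3} sum, which determines both
    bits. *)
Definition theta_bit := tetra_sum G u v w s.
Definition pi_bit := theta_sum G u v w s t (+) theta_bit.

(** The [uniq] guard preserves the value [false] on collapsed squares. *)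
Definition normalized a x b y :=
  G a x b y (+)
    (uniq [:: a; x; b; y] && (theta_bit (+) (pi_bit && ~~ crossing a x b y))).

Hypothesis card_T : (8 < #|T|)%N.
Hypotheses (symG : square_symmetric G) (clG : cube_closed G).
Hypothesis uniq_base : uniq [:: u; v; w; s; t].

Lemma normalized_symmetric : square_symmetric normalized.
Proof.
have [swp trp col] := symG; rewrite /normalized; split=> [a x b y|a x b y|a x y].
- rewrite swp uniq4_swap; congr (_ (+) (_ && (_ (+) (_ && ~~ _)))).
  by rewrite /crossing; do 4!case: (L _ _).
- rewrite trp uniq4_transpose.
  by case: (boolP (uniq _)) => // D; rewrite (crossing_transpose D).
- by rewrite col /= !inE eqxx /= orbT.
Qed.

(* Each facet crosses with the parity of [L] over its four edges, directed from
   the even corners of the cube to the odd ones, and each edge lies in two facets. *)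
Lemma normalized_closed : cube_closed normalized.
Proof.
move=> c c_inj; rewrite -[RHS](clG c_inj) !cube_sumE /= /normalized.
have uniq4 p q r k : uniq [:: p; q; r; k] -> uniq [:: c p; c q; c r; c k].
  by move=> D; rewrite (map_inj_uniq c_inj [:: p; q; r; k]).
rewrite !uniq4; try by rewrite /= !inE !corner_of_eq.
rewrite (@crossing_transpose (c (corner_of true false false))); last first.
  by apply: uniq4; rewrite /= !inE !corner_of_eq.
rewrite (@crossing_transpose (c (corner_of false true false))); last first.
  by apply: uniq4; rewrite /= !inE !corner_of_eq.
rewrite (@crossing_transpose (c (corner_of false false true))); last first.
  by apply: uniq4; rewrite /= !inE !corner_of_eq.
(* The constant bits [p] and [q] enter once per facet, hence six times, and cancel; only the
   crossing bits remain. *)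
have cancel (p q g1 g2 g3 g4 g5 g6 k1 k2 k3 k4 k5 k6 : bool) :
    k1 (+) k2 (+) k3 (+) k4 (+) k5 (+) k6 = false ->
    let f g k := g (+) (true && (p (+) (q && ~~ k))) in
    f g1 k1 (+) f g2 k2 (+) f g3 k3 (+) f g4 k4 (+) f g5 k5 (+) f g6 k6
    = g1 (+) g2 (+) g3 (+) g4 (+) g5 (+) g6.
  move=> E f; rewrite /f (addbACA g1 _ g2) (addbACA _ _ g3) (addbACA _ _ g4).
  rewrite (addbACA _ _ g5) (addbACA _ _ g6) -[RHS]addbF; congr addb; move: E {f}.
  by case: p; case: q; case: k1; case: k2; case: k3; case: k4; case: k5; case: k6.
by apply: cancel; rewrite /crossing; apply: cube_edge_sum.
Qed.

Lemma normalized_tetra : tetra_sum normalized u v w s = false.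
Proof.
rewrite /tetra_sum /normalized; have -> : uniq [:: u; v; w; s] by distinct.
have -> : uniq [:: u; w; v; s] by distinct.
have -> : uniq [:: u; v; s; w] by distinct.
have: theta_bit = G u v w s (+) G u w v s (+) G u v s w by [].
have: crossing u v w s (+) crossing u w v s (+) crossing u v s w = true.
  rewrite /crossing (antiL (_ : v != w)) ?(antiL (_ : s != w)) ?(antiL (_ : s != v));
    try by distinct.
  by do 6!case: (L _ _).
case: pi_bit; case: theta_bit; do 3!case: (crossing _ _ _ _) => //=;
  by do 3!case: (G _ _ _ _).
Qed.

Lemma normalized_theta : theta_sum normalized u v w s t = false.
Proof.
rewrite /theta_sum /normalized; have -> : uniq [:: u; w; v; s] by distinct.
have -> : uniq [:: u; s; v; t] by distinct.
have -> : uniq [:: u; t; v; w] by distinct.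
have: pi_bit = G u w v s (+) G u s v t (+) G u t v w (+) theta_bit by [].
have: crossing u w v s (+) crossing u s v t (+) crossing u t v w = false.
  by rewrite /crossing; do 6!case: (L _ _).
case: pi_bit; case: theta_bit; do 3!case: (crossing _ _ _ _) => //=;
  by do 3!case: (G _ _ _ _).
Qed.

(** By constancy of the sums, normalizing at one K_{2,3} and one K_4 makes all the sums needed for
    [square_potential] vanish. *)
Theorem closed_cochainE a x b y : uniq [:: a; x; b; y] ->
  G a x b y = theta_bit (+) (pi_bit && ~~ crossing a x b y) (+)
    (potential normalized u v w a x (+) potential normalized u v w x b
     (+) potential normalized u v w b y (+) potential normalized u v w y a).
Proof.
move=> D; have symN := normalized_symmetric.
have theta0 a' b' x' y' z' : uniq [:: a'; b'; x'; y'; z'] ->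
    theta_sum normalized a' b' x' y' z' = false.
  move=> D'; rewrite -normalized_theta.
  by apply: theta_sum_const => //; exact: normalized_closed.
have tetra0 a' x' : uniq [:: u; v; a'; x'] -> tetra_sum normalized u v a' x' = false.
  move=> D'; rewrite -normalized_tetra; apply: tetra_sum_const => //.
    exact: leq_trans card_T.
  by distinct.
rewrite -(square_potential symN theta0 _ tetra0 D); last by distinct.
by rewrite /normalized D addbC -addbA addbb addbF.
Qed.

End Normalization.

(** * Testing closedness on few cubes, over F_2 *)

Lemma few_equations (F : fieldType) (I J : finType) (M : I -> J -> F) :
  exists S : {set I}, (#|S| <= #|J|)%N /\
    forall v : J -> F, (forall i, i \in S -> \sum_j M i j * v j = 0) ->
      forall i, \sum_j M i j * v j = 0.
Proof.
pose A := \matrix_(i < #|I|, j < #|J|) M (enum_val i) (enum_val j).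
(* A maximal independent family of rows spans the row space and has at most as many members as there
   are columns. *)
exists [set enum_val (maxrankfun A k) | k : 'I_(\rank A)]; split.
  by rewrite (leq_trans (leq_imset_card _ _)) // cardE size_enum_ord rank_leq_col.
move=> v Sv i; pose c := \col_(j < #|J|) v (enum_val j).
have mulAc k : (A *m c) k 0 = \sum_j M (enum_val k) j * v j.
  rewrite mxE (reindex_onto (@enum_rank J) enum_val) /=; last by move=> j _; rewrite enum_valK.
  apply: eq_big => [j|j _]; first by rewrite enum_rankK eqxx.
  by rewrite !mxE enum_rankK.
have /submxP[D defA] : (A <= rowsub (maxrankfun A) A)%MS by rewrite eq_maxrowsub.
rewrite -[i]enum_rankK -mulAc defA -mulmxA.
suff -> : rowsub (maxrankfun A) A *m c = 0 by rewrite mulmx0 mxE.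
apply/colP=> k.
have kS := Sv _ (imset_f (fun k => enum_val (maxrankfun A k)) (isT : k \in predT)).
by rewrite mul_rowsub_mx [RHS]mxE -[RHS]kS -mulAc mxE.
Qed.

Lemma eq_cube_sum (T T' : finType) (G : T -> T -> T -> T -> bool)
    (G' : T' -> T' -> T' -> T' -> bool) (h : T -> T') y y' :
  (forall a x b z, G a x b z = G' (h a) (h x) (h b) (h z)) ->
  (forall c, h (y c) = y' c) -> cube_sum G y = cube_sum G' y'.
Proof. by move=> eqG eqy; apply: eq_bigr => i _; rewrite /facet_value eqG !eqy. Qed.

Lemma set2_eq (T : finType) (a b c d : T) : [set a; b] = [set c; d] ->
  (a = c /\ b = d) \/ (a = d /\ b = c).
Proof.
move=> E.
have : a \in [set c; d] by rewrite -E set21.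
have : b \in [set c; d] by rewrite -E set22.
have : c \in [set a; b] by rewrite E set21.
have : d \in [set a; b] by rewrite E set22.
rewrite !inE; do 4!case/orP=> /eqP ?; subst; by [left | right].
Qed.

Lemma natr_addb (b c : bool) : (b (+) c)%:R = b%:R + c%:R :> 'F_2.
Proof. by case: b c => [] []; apply/val_inj. Qed.

(* A square is determined by the two pairs of opposite vertices. *)
Lemma few_cubes (T : finType) :
  exists S : {set {ffun corner -> T}},
    [/\ (#|S| <= 'C(#|T|, 2) ^ 2)%N, forall y, y \in S -> injective y &
     forall G, square_symmetric G -> (forall y, y \in S -> cube_sum G y = false) ->
       cube_closed G].
Proof.
pose pair := {D : {set T} | #|D| == 2%N}.
pose inj := {y : {ffun corner -> T} | injectiveb y}.
pose diag (j : pair * pair) a x b y := (val j.1 == [set a; b]) && (val j.2 == [set x; y]).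
pose M (y : inj) j := \sum_(i : 'I_3 * bool)
  (facet_value (diag j) (val y) i)%:R : 'F_2.
have [S [leS testS]] := few_equations M.
exists (val @: S); split.
- rewrite (leq_trans (leq_imset_card _ _)) // (leq_trans leS) //.
  rewrite card_prod card_sig -[X in (X * _)%N]cardsE -[X in (_ * X)%N]cardsE.
  by rewrite -mulnn -!card_draws; apply/eq_leq; congr (_ * _)%N; apply: eq_card => D;
    rewrite !inE.
- by move=> _ /imsetP[y _ ->]; apply/injectiveP; exact: (valP y).
move=> G symG clS y0 inj_y0.
(* The value of [G] at the square with diagonals [j]; it is well defined because [G] is invariant
   under exchanging the ends of either diagonal. *)
pose v (j : pair * pair) : 'F_2 :=
  [exists a, exists x, exists b, exists y, diag j a x b y && G a x b y]%:R.
have sumG a x b y : a != b -> x != y ->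
    \sum_j (diag j a x b y)%:R * v j = (G a x b y)%:R :> 'F_2.
  move=> ne_ab ne_xy.
  have ab2 : #|[set a; b]| == 2%N by rewrite cards2 ne_ab.
  have xy2 : #|[set x; y]| == 2%N by rewrite cards2 ne_xy.
  pose two (D : {set T}) := #|D| == 2%N.
  pose j0 : pair * pair := (exist two _ ab2, exist two _ xy2).
  rewrite (bigD1 j0) //= big1 => [|j ne_j]; last first.
    case: (boolP (diag j a x b y)) => [/andP[/eqP E1 /eqP E2]|_]; last by rewrite mul0r.
    by case/eqP: ne_j; rewrite [j]surjective_pairing; congr (_, _); apply: val_inj.
  rewrite /diag !eqxx mul1r addr0; congr ((nat_of_bool _)%:R).
  apply/existsP/idP=> [[a' /existsP[x' /existsP[b' /existsP[y']]]]|Gt].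
    case/andP=> /andP[/eqP /= /set2_eq E1 /eqP /= /set2_eq E2].
    have [swp trp _] := symG; have mid := fun a x b y => @swap_middle T G a x b y symG.
    by case: E1 E2 => [[-> ->]|[-> ->]] [[-> ->]|[-> ->]] //; rewrite ?[G a' _ _ _]swp // mid.
  exists a; apply/existsP; exists x; apply/existsP; exists b; apply/existsP; exists y.
  by rewrite /diag !eqxx.
have sumM y : \sum_j M y j * v j = (cube_sum G (val y))%:R.
  rewrite /cube_sum (big_morph _ natr_addb (erefl : (false%:R : 'F_2) = 0)).
  rewrite (eq_bigr _ (fun j _ => mulr_suml _ _ _ _)) exchange_big /=.
  have /injectiveP inj_y : injectiveb (val y) := valP y; apply: eq_bigr => i _.
  by apply: sumG; rewrite (inj_eq inj_y) facet_corner_eq.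
pose y1 : {ffun corner -> T} := finfun y0.
have inj_y1 : injectiveb y1.
  by apply/injectiveP=> p q; rewrite !ffunE; exact: inj_y0.
have -> : cube_sum G y0 = cube_sum G y1.
  by apply: (@eq_cube_sum T T G G id) => // c; rewrite ffunE.
have : (cube_sum G y1)%:R = 0 :> 'F_2.
  rewrite -(sumM (exist (fun y : {ffun corner -> T} => injectiveb y) y1 inj_y1)).
  by apply: testS => y yS; rewrite sumM clS // imset_f.
by case: cube_sum => // /eqP.
Qed.

(** * The explicit model, transported along an injection of vertices *)

Lemma potential_pullback (T T' : finType) (h : T -> T') G G' u v w a x :
  injective h -> (forall a x b y, G a x b y = G' (h a) (h x) (h b) (h y)) ->
  potential G u v w a x = potential G' (h u) (h v) (h w) (h a) (h x).
Proof.
move=> inj_h eqG.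
by rewrite /potential /oriented_potential /apex_value !eqG !(inj_eq inj_h).
Qed.

(** The right-hand side of [closed_cochainE], which makes sense for cochains that are not closed. *)
Definition model (T : finType) G (L : rel T) (u v w s t a x b y : T) : bool :=
  theta_bit G u v w s (+) (pi_bit G u v w s t && ~~ crossing L a x b y) (+)
    (potential (normalized G L u v w s t) u v w a x
     (+) potential (normalized G L u v w s t) u v w x b
     (+) potential (normalized G L u v w s t) u v w b y
     (+) potential (normalized G L u v w s t) u v w y a).

(** Closedness is required on the image of [h] alone: the model at such vertices evaluates [G] only
    there, so it agrees with the model of the pullback. *)
Lemma closed_model (T T' : finType) (h : T -> T') G (L : rel T') u v w s t :
  injective h -> (8 < #|T|)%N -> square_symmetric G ->
  cube_closed (fun a x b y => G (h a) (h x) (h b) (h y)) ->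
  (forall a b, a != b -> L a b = ~~ L b a) -> uniq [:: u; v; w; s; t] ->
  forall a x b y, uniq [:: a; x; b; y] ->
  G (h a) (h x) (h b) (h y) =
  model G L (h u) (h v) (h w) (h s) (h t) (h a) (h x) (h b) (h y).
Proof.
move=> inj_h card_T [swp trp col] clG antiL D0 a x b y D.
have symG : square_symmetric (fun a x b y => G (h a) (h x) (h b) (h y)).
  by split=> *; [exact: swp | exact: trp | exact: col].
have antiL' c d : c != d -> L (h c) (h d) = ~~ L (h d) (h c).
  by move=> ne_cd; rewrite antiL ?(inj_eq inj_h).
rewrite (@closed_cochainE T _ (relpre h L) antiL' u v w s t card_T symG clG D0 _ _ _ _ D).
have eqN c k d l : normalized (fun a x b y => G (h a) (h x) (h b) (h y)) (relpre h L) u v w s t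
  c k d l
    = normalized G L (h u) (h v) (h w) (h s) (h t) (h c) (h k) (h d) (h l).
  by rewrite /normalized -(map_inj_uniq inj_h).
by rewrite !(potential_pullback _ _ _ _ _ inj_h eqN).
Qed.

(** * Squares and cubes as edge sets *)

Lemma corner_ofK (c : corner) : corner_of (c ord0) (c (inord 1)) (c (inord 2)) = c.
Proof.
apply/ffunP=> i; rewrite ffunE.
by case: i => [[|[|[|]]]] //= lt_i; congr (c _); apply/val_inj; rewrite /= ?inordK.
Qed.

Lemma corner_adjE b0 b1 b2 d0 d1 d2 :
  corner_adj (corner_of b0 b1 b2) (corner_of d0 d1 d2) =
  ((b0 != d0) + (b1 != d1) + (b2 != d2) == 1)%N.
Proof.
rewrite /corner_adj -sum1_card (eq_bigl _ _ (fun i => in_set _ i)) big_mkcond /=.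
rewrite !big_ord_recl big_ord0 !ffunE /= addn0 addnA.
by case: (b0 != d0); case: (b1 != d1); case: (b2 != d2).
Qed.

Lemma facet_corner_adj a b s t s' t' :
  corner_adj (facet_corner a b s t) (facet_corner a b s' t') = (s != s') (+) (t != t').
Proof.
case: a => [[|[|[|]]] lt_a] //; rewrite /facet_corner /= corner_adjE eqxx.
all: by case: (s != s'); case: (t != t').
Qed.

Lemma facet_corner_fix a b s t : facet_corner a b s t a = b.
Proof. by case: a => [[|[|[|]]] lt_a] //; rewrite /facet_corner /= ffunE. Qed.

Lemma facet_cornerP (c : corner) a : exists s t, c = facet_corner a (c a) s t.
Proof.
case: a => [[|[|[|]]] lt_a] //; rewrite /facet_corner /= -{1}(corner_ofK c).
- exists (c (inord 1)), (c (inord 2)); congr corner_of; congr (c _); exact/val_inj.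
- exists (c ord0), (c (inord 2)); congr corner_of; congr (c _); apply/val_inj.
  by rewrite /= inordK.
- exists (c ord0), (c (inord 1)); congr corner_of; congr (c _); apply/val_inj.
  by rewrite /= inordK.
Qed.

(* Two consecutive edges at [c0] change two of the three coordinates, so the
   third one is constant along a 4-cycle. *)
Lemma corner_cycle4 (c0 c1 c2 c3 : corner) :
  [&& corner_adj c0 c1, corner_adj c1 c2, corner_adj c2 c3 & corner_adj c3 c0] ->
  c0 != c2 -> c1 != c3 ->
  exists a, [/\ c1 a = c0 a, c2 a = c0 a & c3 a = c0 a].
Proof.
pose P a := [&& c1 a == c0 a, c2 a == c0 a & c3 a == c0 a].
suff: [&& corner_adj c0 c1, corner_adj c1 c2, corner_adj c2 c3 & corner_adj c3 c0] ->
  c0 != c2 -> c1 != c3 -> [|| P ord0, P (inord 1) | P (inord 2)].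
  move=> H C N N'; case/or3P: (H C N N') => /and3P[/eqP ? /eqP ? /eqP ?].
  - by exists ord0.
  - by exists (inord 1).
  - by exists (inord 2).
rewrite /P -(corner_ofK c0) -(corner_ofK c1) -(corner_ofK c2) -(corner_ofK c3).
rewrite !corner_adjE !corner_of_eq !ffunE !inordK //=.
by do 12!case: (fun_of_fin _ _).
Qed.

Section Cells.
Variable V : finType.
Implicit Types (a b x y i j k l : V) (c : {ffun corner -> V}).

Lemma cycle4_swap a x b y : cycle4 b x a y = cycle4 a x b y.
Proof.
rewrite /cycle4 (setUC [set b] [set x]) (setUC [set x] [set a]).
rewrite (setUC [set a] [set y]) (setUC [set y] [set b]).
by apply/setP=> e; rewrite !inE; do 4!case: (e == _).
Qed.

Lemma cycle4_transpose a x b y : cycle4 x a y b = cycle4 a x b y.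
Proof.
rewrite /cycle4 (setUC [set x] [set a]) (setUC [set a] [set y]).
rewrite (setUC [set y] [set b]) (setUC [set b] [set x]).
by apply/setP=> e; rewrite !inE; do 4!case: (e == _).
Qed.

Definition edges4 a x b y : seq {set V} := [:: [set a; x]; [set x; b]; [set b; y]; [set y; a]].

Lemma mem_cycle4 e a x b y : (e \in cycle4 a x b y) = (e \in edges4 a x b y).
Proof. by rewrite !inE -!orbA. Qed.

Lemma set2_eqE a b x y :
  ([set a; b] == [set x; y]) = (a == x) && (b == y) || (a == y) && (b == x).
Proof.
apply/eqP/orP=> [/set2_eq [[-> ->]|[-> ->]]|[/andP[/eqP-> /eqP->] //|/andP[/eqP-> /eqP->]]].
- by left; rewrite !eqxx.
- by right; rewrite !eqxx.
- exact: setUC.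
Qed.

Lemma edges4_uniq a x b y : uniq [:: a; x; b; y] -> uniq (edges4 a x b y).
Proof.
rewrite /= !inE !negb_or !andbT => /and3P[/and3P[ax ab ay] /andP[xb xy] bY].
have E := (negPf ax, negPf ab, negPf ay, negPf xb, negPf xy, negPf bY).
by rewrite !set2_eqE ?E ?eqxx ?(eq_sym x a) ?(eq_sym b a) ?(eq_sym y a) ?(eq_sym b x)
  ?(eq_sym y x) ?(eq_sym y b) ?E ?andbF.
Qed.

Lemma card_cycle4 a x b y : uniq [:: a; x; b; y] -> #|cycle4 a x b y| = 4%N.
Proof.
move=> /edges4_uniq /card_uniqP card4; rewrite -[RHS]card4.
by apply: eq_card => e; rewrite mem_cycle4.
Qed.

(** The neighbours of a vertex in a 4-cycle are the ends of the diagonal avoiding it, so the edge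
    set determines both diagonals. *)
Lemma cycle4_eq_diagonals i j k l a x b y : uniq [:: i; j; k; l] -> uniq [:: a; x; b; y] ->
  cycle4 i j k l = cycle4 a x b y ->
  [set i; k] = [set a; b] /\ [set j; l] = [set x; y] \/
  [set i; k] = [set x; y] /\ [set j; l] = [set a; b].
Proof.
pose nb (E : {set {set V}}) z := [set t | [set z; t] \in E].
have nbE p q r m : uniq [:: p; q; r; m] ->
    [/\ nb (cycle4 p q r m) p = [set q; m], nb (cycle4 p q r m) q = [set p; r],
        nb (cycle4 p q r m) r = [set q; m] & nb (cycle4 p q r m) m = [set p; r]].
  rewrite /= !inE !negb_or !andbT => /and3P[/and3P[pq pr pm] /andP[qr qm] rm].
  have E := (negPf pq, negPf pr, negPf pm, negPf qr, negPf qm, negPf rm).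
  split; apply/setP=> t; rewrite !inE !set2_eqE ?eqxx.
  all: rewrite ?E ?(eq_sym q p) ?(eq_sym r p) ?(eq_sym m p) ?(eq_sym r q) ?(eq_sym m q)
    ?(eq_sym m r) ?E.
  all: rewrite /= ?orbF ?orFb; try by do 2!case: (t == _).
move=> D D' E; have [Ni Nj Nk Nl] := nbE _ _ _ _ D; have [Na Nx Nb Ny] := nbE _ _ _ _ D'.
have : [set i; j] \in cycle4 a x b y by rewrite -E mem_cycle4 mem_head.
rewrite E in Ni Nj.
rewrite mem_cycle4 !inE => /or4P[] /eqP /set2_eq [] [Ei Ej].
all: move: Ni Nj; rewrite Ei Ej ?Na ?Nx ?Nb ?Ny => <- <-; by [left | right].
Qed.

Lemma facet_graphE c (i : 'I_3) (b : bool) :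
  facet_graph c i b =
  cycle4 (c (facet_corner i b false false)) (c (facet_corner i b true false))
         (c (facet_corner i b true true)) (c (facet_corner i b false true)).
Proof.
pose v s t := c (facet_corner i b s t); apply/setP=> e; rewrite mem_cycle4; apply/imsetP/idP.
- case=> [[p q]]; rewrite inE /= => /and3P[adj /eqP pb /eqP qb] ->.
  have [s [t Ep]] := facet_cornerP p i; have [s' [t' Eq]] := facet_cornerP q i.
  rewrite pb in Ep; rewrite qb in Eq; move: adj;
    rewrite Ep Eq facet_corner_adj -/(v s t) -/(v s' t').
  by case: s {Ep}; case: t; case: s' {Eq}; case: t' => //= _;
    rewrite /edges4 !inE ?eqxx ?orbT // setUC eqxx ?orbT.
- rewrite !inE => /or4P[] /eqP ->.
  + by exists (facet_corner i b false false, facet_corner i b true false);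
      rewrite // inE /= facet_corner_adj !facet_corner_fix !eqxx.
  + by exists (facet_corner i b true false, facet_corner i b true true);
      rewrite // inE /= facet_corner_adj !facet_corner_fix !eqxx.
  + by exists (facet_corner i b true true, facet_corner i b false true);
      rewrite // inE /= facet_corner_adj !facet_corner_fix !eqxx.
  + by exists (facet_corner i b false true, facet_corner i b false false);
      rewrite // inE /= facet_corner_adj !facet_corner_fix !eqxx.
Qed.


Lemma facet_uniq c (i : 'I_3) (b : bool) : injective c ->
  uniq [:: c (facet_corner i b false false); c (facet_corner i b true false);
           c (facet_corner i b true true); c (facet_corner i b false true)].
Proof.
move=> inj_c; pose p := facet_corner i b.
suff: uniq (map c [:: p false false; p true false; p true true; p false true]) by [].
by rewrite map_inj_uniq //= !inE !facet_corner_eq.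
Qed.

Lemma cube_graphP c x y : [set x; y] \in cube_graph c ->
  exists p q, [/\ corner_adj p q, x = c p & y = c q].
Proof.
case/imsetP=> [[p q]]; rewrite inE /= => adj /set2_eq [[-> ->]|[-> ->]].
  by exists p, q.
exists q, p; split=> //; move: adj; rewrite /corner_adj.
by under eq_finset do rewrite eq_sym.
Qed.

Lemma facet_sub_cube c (i : 'I_3) (b : bool) : facet_graph c i b \subset cube_graph c.
Proof.
by apply/subsetP=> e /imsetP[[p q]]; rewrite inE /= => /and3P[adj _ _] ->; apply/imsetP;
  exists (p, q); rewrite ?inE.
Qed.

(** The 4-cycle lifts to corners, where [corner_cycle4] fixes a coordinate; it then lies in a facet
    with equally many edges. Thus one parametrisation of a cube shows all its faces, although
    [is_face] ranges over all parametrisations. *)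
Lemma square_in_cube c i j k l : injective c ->
  uniq [:: i; j; k; l] -> cycle4 i j k l \subset cube_graph c ->
  exists (a : 'I_3) (b : bool), cycle4 i j k l = facet_graph c a b.
Proof.
move=> inj_c D /subsetP sub.
have edge e : e \in edges4 i j k l -> e \in cube_graph c.
  by rewrite -mem_cycle4; apply: sub.
have [|p [q [adj_pq Ei Ej]]] := @cube_graphP c i j; first by apply: edge; rewrite !inE eqxx.
have [|q' [r [adj_qr Ej' Ek]]] := @cube_graphP c j k; first by apply: edge;
  rewrite !inE eqxx ?orbT.
have [|r' [m [adj_rm Ek' El]]] := @cube_graphP c k l; first by apply: edge;
  rewrite !inE eqxx ?orbT.
have [|m' [p' [adj_mp El' Ei']]] := @cube_graphP c l i; first by apply: edge;
  rewrite !inE eqxx ?orbT.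
have Eq : q' = q by apply: inj_c; rewrite -Ej.
have Er : r' = r by apply: inj_c; rewrite -Ek.
have Em : m' = m by apply: inj_c; rewrite -El.
have Ep : p' = p by apply: inj_c; rewrite -Ei.
subst q' r' m' p'.
have ne_pr : p != r by rewrite -(inj_eq inj_c) -Ei -Ek; distinct.
have ne_qm : q != m by rewrite -(inj_eq inj_c) -Ej -El; distinct.
have [a [Ha Hb Hc]] := @corner_cycle4 p q r m ltac:(by apply/and4P) ne_pr ne_qm.
exists a, (p a); apply/eqP; rewrite eqEcard.
have -> : #|facet_graph c a (p a)| = 4%N.
  by rewrite facet_graphE card_cycle4 // facet_uniq.
rewrite card_cycle4 // leqnn andbT; apply/subsetP=> e; rewrite mem_cycle4 !inE.
case/or4P=> /eqP ->; apply/imsetP.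
- by exists (p, q); rewrite ?inE /= ?adj_pq ?Ha ?eqxx ?Ei ?Ej.
- by exists (q, r); rewrite ?inE /= ?adj_qr ?Ha ?Hb ?eqxx ?Ej ?Ek.
- by exists (r, m); rewrite ?inE /= ?adj_rm ?Hb ?Hc ?eqxx ?Ek ?El.
- by exists (m, p); rewrite ?inE /= ?adj_mp ?Hc ?eqxx ?El ?Ei.
Qed.

End Cells.

(** * Translation between signs and bits *)

Lemma mu2P (m : int) : m \in mu2 -> m = (-1) ^+ (m == -1).
Proof. by rewrite !inE => /orP[] /eqP ->. Qed.

Section Bits.
Variable V : finType.
Implicit Types (g : {ffun square V -> int}) (c : {ffun corner -> V}).

(** The bit is set when the value is -1. The guard gives [false] on collapsed squares, and under it
    [insub] always succeeds. *)
Definition square_bit g (a x b y : V) : bool :=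
  uniq [:: a; x; b; y] && (if insub (cycle4 a x b y) is Some q then g q == -1 else false).

Lemma square_bit_symmetric g : square_symmetric (square_bit g).
Proof.
rewrite /square_bit; split=> [a x b y|a x b y|a x y].
- by rewrite cycle4_swap uniq4_swap.
- by rewrite cycle4_transpose uniq4_transpose.
- by rewrite /= !inE eqxx /= orbT.
Qed.

Lemma square_bitE g q a x b y : g \in cochain (square V) -> uniq [:: a; x; b; y] ->
  val q = cycle4 a x b y -> g q = (-1) ^+ square_bit g a x b y.
Proof.
move=> /ffun_onP /(_ q) /mu2P {1}-> D Eq.
by rewrite /square_bit D -Eq valK.
Qed.

Lemma cycle4_is_square a x b y : uniq [:: a; x; b; y] -> is_square (@cycle4 V a x b y).
Proof.
move=> D; do 4![apply/existsP; eexists]; apply/andP; split; last exact: eqxx.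
exact: D.
Qed.

Lemma facet_is_square c i b : injective c -> is_square (facet_graph c i b).
Proof. by move=> inj_c; rewrite facet_graphE cycle4_is_square // facet_uniq. Qed.

(** Every corner of a facet lies on an edge of it, so equal edge sets cover the same corners. *)
Lemma facet_graph_inj c a b a' b' : injective c ->
  facet_graph c a b = facet_graph c a' b' -> (a, b) = (a', b').
Proof.
move=> inj_c E.
have incl (p : corner) : p a = b -> p a' = b'.
  move=> pa; have [s [t]] := facet_cornerP p a; rewrite pa => Ep.
  have : [set c p; c (facet_corner a b (~~ s) t)] \in facet_graph c a b.
    apply/imsetP; exists (p, facet_corner a b (~~ s) t) => //.
    rewrite inE /= {1}Ep facet_corner_adj pa facet_corner_fix !eqxx.
    by case: s {Ep}; rewrite addbF.
  rewrite E => /imsetP[[q r]]; rewrite inE /= => /and3P[_ /eqP qa /eqP ra].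
  by case/set2_eq=> [[/inj_c -> _]|[/inj_c -> _]].
(* This corner takes the value [~~ b'] at every coordinate other than [a], which forces [a' = a]. *)
have := incl [ffun k => if k == a then b else ~~ b']; rewrite !ffunE eqxx => /(_ erefl).
by have [-> ->|_] := eqVneq a' a; last by case: (b').
Qed.

(** By [square_in_cube] the faces of [C] are the facets of the parametrisation [c], and by
    [facet_graph_inj] these six are distinct. *)
Lemma delta2E g (C : cube V) c : g \in cochain (square V) -> injective c ->
  val C = cube_graph c -> delta2 g C = (-1) ^+ cube_sum (square_bit g) c.
Proof.
move=> g_mu inj_c EC; rewrite ffunE.
pose face (i : 'I_3 * bool) : square V :=
  exist (@is_square V) _ (facet_is_square i.1 i.2 inj_c).
have face_inj : injective face.
  move=> i j /(congr1 val) /=; case: i j => [a b] [a' b'] /=; exact: facet_graph_inj.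
have faceP q : is_face q C = (q \in [set face i | i : 'I_3 * bool]).
  apply/existsP/imsetP=> [[c' /and3P[/injectiveP inj_c' /eqP EC' /existsP[a
    /existsP[b /eqP Eq]]]]|[i _ ->]].
    have sub : facet_graph c' a b \subset cube_graph c by rewrite -EC EC' facet_sub_cube.
    rewrite facet_graphE in Eq sub.
    have [a' [b' E]] := square_in_cube inj_c (facet_uniq a b inj_c') sub.
    by exists (a', b') => //; apply: val_inj; rewrite Eq E.
  exists c; rewrite EC eqxx; apply/and3P; split=> //; first exact/injectiveP.
  by apply/existsP; exists i.1; apply/existsP; exists i.2.
rewrite (eq_bigl _ _ faceP) big_imset /=; last by move=> i j _ _; exact: face_inj.
rewrite /cube_sum (big_morph (fun b : bool => (-1) ^+ b : int) (@signr_addb int)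
  (erefl : (-1 : int) ^+ false = 1)).
apply: eq_big => [i|i _]; first by rewrite inE.
by rewrite (square_bitE g_mu (facet_uniq i.1 i.2 inj_c)) //= facet_graphE.
Qed.

(** Symmetry of [P] makes the bit of an edge independent of the order of its ends, and the four
    edges of a square are distinct. *)
Lemma delta1E (P : rel V) (q : square V) a x b y :
  (forall k l, P k l = P l k) -> uniq [:: a; x; b; y] -> val q = cycle4 a x b y ->
  delta1 [ffun e : edge V =>
    (-1) ^+ [exists k, exists l, (val e == [set k; l]) && P k l]] q =
  (-1) ^+ (P a x (+) P x b (+) P b y (+) P y a).
Proof.
move=> symP D Eq; rewrite ffunE Eq.
have edgeP k l : [exists k', exists l', ([set k; l] == [set k'; l']) && P k' l'] = P k l.
  apply/existsP/idP=> [[k' /existsP[l' /andP[/eqP /set2_eq E]]]|Pkl].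
    by case: E => [[-> ->]|[-> ->]] //; rewrite symP.
  by exists k; apply/existsP; exists l; rewrite eqxx.
have two (k l : V) : k != l -> #|[set k; l]| == 2%N by rewrite cards2 => ->.
pose ed (k l : V) (kl : k != l) : edge V := exist (fun E : {set V} => #|E| == 2%N) _ (two k l kl).
have ax : a != x by distinct. have xb : x != b by distinct.
have bY : b != y by distinct. have ya : y != a by distinct.
pose es := [:: ed _ _ ax; ed _ _ xb; ed _ _ bY; ed _ _ ya].
have mem_es e : (val e \in cycle4 a x b y) = (e \in es).
  by rewrite mem_cycle4 !inE -!val_eqE.
have uniq_es : uniq es by rewrite -(map_inj_uniq val_inj) edges4_uniq.
rewrite (eq_bigl _ _ mem_es) -big_uniq //= !big_cons big_nil !ffunE /= !edgeP.
by rewrite mulr1 -!signr_addb !addbA.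
Qed.

End Bits.

(** An increasing reading has crossing diagonals, and crossing depends on the diagonals only.
    Conversely, the positions of crossing diagonals give the increasing reading. *)
Lemma increasing_squareE d (V : finOrderType d) (q : square V) a x b y :
  uniq [:: a; x; b; y] -> val q = cycle4 a x b y ->
  increasing_square q = crossing (fun k l => (k < l)%O) a x b y.
Proof.
move=> D Eq; have antiL (k l : V) : k != l -> (k < l)%O = ~~ (l < k)%O.
  by move=> ne_kl; rewrite -leNgt lt_neqAle ne_kl.
apply/idP/idP=> [|].
- case/existsP=> i /existsP[j /existsP[k /existsP[l /and4P[ij jk kl /eqP]]]].
  rewrite Eq => /esym E.
  have ik := lt_trans ij jk; have jl := lt_trans jk kl; have il := lt_trans ij jl.
  have D' : uniq [:: i; j; k; l].
    by rewrite /= !inE !negb_or !lt_eqF.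
  have Tijkl : crossing (fun k l => (k < l)%O) i j k l.
    by rewrite /crossing ij il kl [(k < j)%O]ltNge (ltW jk).
  move: Tijkl; have [[/set2_eq E1 /set2_eq E2]|[/set2_eq E1 /set2_eq E2]] :=
    cycle4_eq_diagonals D' D E.
    case: E1 E2 => [[<- <-]|[<- <-]] [[<- <-]|[<- <-]]; rewrite /crossing;
    by do 4!case: (_ < _)%O.
  rewrite (crossing_transpose antiL D).
  case: E1 E2 => [[<- <-]|[<- <-]] [[<- <-]|[<- <-]]; rewrite /crossing;
  by do 4!case: (_ < _)%O.
- have inc i j k l : (i < j)%O -> (j < k)%O -> (k < l)%O ->
      cycle4 a x b y = cycle4 i j k l -> increasing_square q.
    move=> ij jk kl E; apply/existsP; exists i; apply/existsP; exists j.
    by apply/existsP; exists k; apply/existsP; exists l; rewrite ij jk kl Eq E /=.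
  (* For [a < b], crossing means that exactly one of [x] and [y] lies between [a] and [b]; the other
     one comes first or last in the reading. *)
  wlog ab : a b D Eq inc / (a < b)%O => [wlogH|].
    have [ab|ba|eq_ab] := ltgtP a b; first exact: wlogH.
      move=> cr; apply: (wlogH b a) => //.
      - by distinct.
      - by rewrite cycle4_swap.
      - by move=> i j k l; rewrite cycle4_swap; apply: inc.
      - by move: cr; rewrite /crossing; do 4!case: (_ < _)%O.
    by move: D; rewrite eq_ab /= !inE eqxx orbT.
  have mid_eq : cycle4 a y b x = cycle4 a x b y.
    by rewrite -cycle4_transpose cycle4_swap cycle4_transpose.
  have [ax' bx' ay' by'] : [/\ a != x, b != x, a != y & b != y] by split; distinct.
  rewrite /crossing; have [ya|ay] := leP y a.
    have -> : (b < y)%O = false by rewrite ltNge (ltW (le_lt_trans ya ab)).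
    have [xa|ax] := leP x a.
      by have -> : (b < x)%O = false by rewrite ltNge (ltW (le_lt_trans xa ab)).
    have [xb _|//] := leP x b.
    apply: (inc y a x b) => //; first by rewrite lt_neqAle eq_sym ay'.
      by rewrite lt_neqAle eq_sym bx'.
    by rewrite -cycle4_transpose cycle4_swap.
  have [yb|b_y] := leP y b.
    have y_b : (y < b)%O by rewrite lt_neqAle eq_sym by'.
    have [xa|ax] := leP x a.
      move=> _; apply: (inc x a y b) => //; first by rewrite lt_neqAle eq_sym ax'.
      by rewrite cycle4_transpose.
    have [//|bx] := leP x b.
    by move=> _; apply: (inc a y b x).
  have [xa|ax] := leP x a.
    by have -> : (b < x)%O = false by rewrite ltNge (ltW (le_lt_trans xa ab)).
  have [xb _|//] := leP x b.
  by apply: (inc a x b y) => //; rewrite lt_neqAle eq_sym bx'.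
Qed.

(** * Averaging over random permutations *)

Lemma extend_to_perm (I T : finType) (f f' : I -> T) : injective f -> injective f' ->
  exists s : {perm T}, forall i, s (f i) = f' i.
Proof.
move=> inj_f inj_f'.
have dtuple (h : I -> T) : injective h -> codom_tuple h \in #|I|.-dtuple([set: T]).
  by move=> inj_h; rewrite inE; apply/andP; split; [exact/injectiveP | exact/subsetP].
have le_IT : (#|I| <= #|T|)%N by exact: leq_card inj_f.
(* The symmetric group on [T] is #|T|-transitive, hence #|I|-transitive; the tuples list [f] and
   [f'] along the enumeration of [I]. *)
have tr := ntransitive_weak le_IT (Sym_trans T).
have [s _ E] := atransP2 tr (dtuple f inj_f) (dtuple f' inj_f').
have tnthE (h : I -> T) i : tnth (codom_tuple h) (enum_rank i) = h i.
  by rewrite (tnth_nth (h i)) /= nth_codom enum_rankK.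
exists s => i; have := congr1 (fun t => tnth t (enum_rank i)) E.
by rewrite tnthE tnth_map tnthE => ->.
Qed.

Lemma card_predE (X : finType) (B : pred X) : #|B| = (\sum_x B x)%N.
Proof.
rewrite -sum1_card big_mkcond; apply: eq_bigr => x _; rewrite unfold_in.
by case: (B x).
Qed.

Lemma card_setE (X : finType) (B : pred X) : #|[set x | B x]| = (\sum_x B x)%N.
Proof. by rewrite -card_predE; apply: eq_card => x; rewrite inE. Qed.

(** Double counting of the pairs (s, x) with [B (act s x)]: by transitivity the count over [s] is
    the same for every [x], and each [act s] is a bijection of [X]. In other words, [act s x0] is
    uniform for uniform [s]. *)
Lemma transitive_average (gT : finGroupType) (X : finType) (act : gT -> X -> X)
    (B : pred X) x0 :
  (forall s, injective (act s)) -> (forall s t x, act (s * t)%g x = act t (act s x)) ->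
  (forall x, exists t, act t x0 = x) ->
  (#|[set s | B (act s x0)]| * #|X| = #|B| * #|gT|)%N.
Proof.
move=> inj_act actM trans.
have const x : #|[set s | B (act s x)]| = #|[set s | B (act s x0)]|.
  have [t <-] := trans x.
  rewrite -(card_imset _ (mulgI t)); apply: eq_card => s.
  apply/imsetP/idP=> [[s' +] ->|Bs]; first by rewrite !inE actM.
  by exists (t^-1 * s)%g; rewrite ?mulKVg // inE -actM mulKVg; move: Bs; rewrite inE.
have sumB s : (\sum_x B (act s x) = #|B|)%N.
  by rewrite card_predE [RHS](reindex_inj (inj_act s)).
have sumS x : (\sum_s B (act s x) = #|[set s | B (act s x0)]|)%N.
  by rewrite -(const x) card_setE.
transitivity (\sum_x \sum_s B (act s x))%N.
  by rewrite (eq_bigr _ (fun x _ => sumS x)) sum_nat_const mulnC.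
by rewrite exchange_big /= (eq_bigr _ (fun s _ => sumB s)) sum_nat_const mulnC.
Qed.

Section Action.
Variable V : finType.
Implicit Types (s : {perm V}) (c : {ffun corner -> V}).

Definition act_graph s (E : {set {set V}}) : {set {set V}} := [set s @: e | e : {set V} in E].

Lemma act_graphM s t E : act_graph (s * t)%g E = act_graph t (act_graph s E).
Proof.
rewrite /act_graph -imset_comp; apply: eq_imset => e /=.
by rewrite -imset_comp; apply: eq_imset => x; rewrite permM.
Qed.

Lemma act_graph_inj s : injective (act_graph s).
Proof. exact: imset_inj (imset_inj perm_inj). Qed.

Lemma act_cycle4 s a x b y : act_graph s (cycle4 a x b y) = cycle4 (s a) (s x) (s b) (s y).
Proof. by rewrite /act_graph /cycle4 !imsetU !imset_set1 !imsetU !imset_set1. Qed.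

Lemma act_cube_graph s c : act_graph s (cube_graph c) = cube_graph [ffun p => s (c p)].
Proof.
rewrite /act_graph /cube_graph -imset_comp; apply: eq_imset => -[p q] /=.
by rewrite imsetU !imset_set1 !ffunE.
Qed.

Lemma squareP (q : square V) :
  exists a x b y, uniq [:: a; x; b; y] /\ val q = cycle4 a x b y.
Proof.
have /existsP[a /existsP[x /existsP[b /existsP[y /andP[D /eqP E]]]]] := valP q.
by exists a, x, b, y.
Qed.

Lemma cubeP (C : cube V) : exists2 c : {ffun corner -> V}, injective c & val C = cube_graph c.
Proof.
by have /existsP[c /andP[/injectiveP inj_c /eqP E]] := valP C; exists c.
Qed.

Lemma cube_graph_is_cube c : injective c -> is_cube (cube_graph c).
Proof. by move=> /injectiveP inj_c; apply/existsP; exists c; rewrite inj_c eqxx. Qed.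

Lemma act_is_square s (q : square V) : is_square (act_graph s (val q)).
Proof.
have [a [x [b [y [D ->]]]]] := squareP q; rewrite act_cycle4 cycle4_is_square //.
by rewrite (map_inj_uniq (@perm_inj _ s) [:: a; x; b; y]).
Qed.

Lemma act_corners_inj s c : injective c -> injective [ffun p => s (c p)].
Proof. by move=> inj_c p q; rewrite !ffunE => /perm_inj /inj_c. Qed.

Lemma act_is_cube s (C : cube V) : is_cube (act_graph s (val C)).
Proof.
have [c inj_c ->] := cubeP C.
by rewrite act_cube_graph cube_graph_is_cube //; exact: act_corners_inj.
Qed.

Definition act_square s q : square V := exist (@is_square V) _ (act_is_square s q).
Definition act_cube s C : cube V := exist (@is_cube V) _ (act_is_cube s C).

Lemma act_square_inj s : injective (act_square s).
Proof. by move=> q q' /(congr1 val) /act_graph_inj /val_inj. Qed.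

(** Permutations are transitive on cubes, because any injective labelling of the corners can be
    carried to any other. *)
Lemma cube_average (B : pred (cube V)) (C : cube V) :
  (#|[set s : {perm V} | B (act_cube s C)]| * #|{: cube V}| = #|B| * #|{: {perm V}}|)%N.
Proof.
apply: transitive_average => [s C1 C2 /(congr1 val) /act_graph_inj /val_inj //|s t C'|C'].
  by apply: val_inj; rewrite /= act_graphM.
have [c inj_c E] := cubeP C; have [c' inj_c' E'] := cubeP C'.
have [s sE] := extend_to_perm inj_c inj_c'.
exists s; apply: val_inj; rewrite /= E E' act_cube_graph; congr cube_graph.
by apply/ffunP=> p; rewrite ffunE.
Qed.

(** Repetitions in [l] are allowed, since the base may meet the square; the list without them is
    filled up with further vertices. *)
Lemma nine_points (z0 : V) (l : seq V) : (size l <= 9 <= #|V|)%N ->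
  exists2 h : 'I_9 -> V, injective h & forall z, z \in l -> exists i, h i = z.
Proof.
case/andP=> le_l le_V; pose m := undup l ++ [seq z <- enum V | z \notin l].
have uniq_m : uniq m.
  rewrite cat_uniq undup_uniq filter_uniq ?enum_uniq // andbT.
  by apply/hasPn=> z; rewrite mem_filter mem_undup => /andP[].
have size_m : size m = #|V|.
  rewrite cardE; apply/perm_size/uniq_perm; rewrite ?enum_uniq // => z.
  by rewrite mem_cat mem_undup mem_filter mem_enum andbT orbN.
exists (fun i => nth z0 m i) => [i j /eqP|z z_l].
  by rewrite nth_uniq ?size_m ?(leq_trans (ltn_ord _)) // => /eqP /val_inj.
have lt_z : (index z (undup l) < size (undup l))%N by rewrite index_mem mem_undup.
exists (Ordinal (leq_trans lt_z (leq_trans (size_undup l) le_l))) => /=.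
by rewrite nth_cat lt_z nth_index // mem_undup.
Qed.

End Action.

(** * Bad squares counted by bad cubes *)

Section Stability.
Variables (d : Order.disp_t) (V : finOrderType d) (g : {ffun square V -> int}).
Hypothesis g_mu : g \in cochain (square V).

Local Notation G := (square_bit g).
Local Notation L := (fun k l : V => (k < l)%O).

Section Base.
Variables u v w s t : V.

Definition theta_sign : int := (-1) ^+ theta_bit G u v w s.
Definition pi_sign : int := (-1) ^+ pi_bit G u v w s t.
Definition potential_cochain : {ffun edge V -> int} :=
  [ffun e : edge V => (-1) ^+ [exists k, exists l,
     (val e == [set k; l]) && potential (normalized G L u v w s t) u v w k l]].

Definition model_cochain : {ffun square V -> int} :=
  [ffun q => theta_sign * order_cochain V pi_sign q * delta1 potential_cochain q].

Lemma model_cochainE q a x b y : uniq [:: a; x; b; y] -> val q = cycle4 a x b y ->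
  model_cochain q = (-1) ^+ model G L u v w s t a x b y.
Proof.
move=> D Eq; rewrite ffunE (delta1E (@potentialC _ _ u v w) D Eq) /model.
rewrite [RHS]signr_addb [X in _ = X * _]signr_addb.
congr (_ * _ * _); rewrite /order_cochain ffunE (increasing_squareE D Eq) /pi_sign.
by case: pi_bit; case: crossing.
Qed.

End Base.

Definition bad_cube : pred (cube V) := [pred C | delta2 g C != 1].

Variables u v w s t : V.
Hypothesis uniq_base : uniq [:: u; v; w; s; t].

(** The permutation moves the base only; the order on [V] stays fixed. *)
Definition bad_square (p : {perm V}) : pred (square V) :=
  [pred q | g q != model_cochain (p u) (p v) (p w) (p s) (p t) q].

(** The tested cubes are chosen before [p], on nine vertices containing the base and the square. If
    all their images are good, the cochain is closed on the image of these vertices and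
    [closed_model] applies. *)
Lemma bad_square_witness (q : square V) : (8 < #|V|)%N ->
  exists S : {set cube V}, (#|S| <= 1296)%N /\
    forall p, bad_square p (act_square p q) ->
      exists2 C, C \in S & bad_cube (act_cube p C).
Proof.
move=> card_V; have [a [x [b [y [D Eq]]]]] := squareP q.
have [|h inj_h cover] := @nine_points V u [:: u; v; w; s; t; a; x; b; y].
  exact: card_V.
have [S [leS injS testS]] := few_cubes 'I_9.
have inj_hc (c : {ffun corner -> 'I_9}) : injective c -> injective [ffun k => h (c k)].
  by move=> inj_c k l; rewrite !ffunE => /inj_h /inj_c.
exists [set C : cube V | [exists c in S, val C == cube_graph [ffun k => h (c k)]]]; split.
  rewrite -(card_imset _ val_inj).
  apply: leq_trans (_ : #|[set cube_graph [ffun k => h (c k)] | c : {ffun corner -> 'I_9}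
    in S]| <= _)%N.
    apply/subset_leq_card/subsetP=> _ /imsetP[C + ->].
    rewrite inE => /existsP[c /andP[cS /eqP ->]]; exact: imset_f.
  (* Here 'C(9, 2) ^ 2 = 36 ^ 2 = 1296. *)
  by rewrite (leq_trans (leq_imset_card _ _)) // (leq_trans leS) // card_ord.
move=> p bad_q; apply/exists_inP; apply: contraTT bad_q => /exists_inPn no_bad.
have ph_inj : injective (fun i => p (h i)) by move=> i j /perm_inj /inj_h.
have closed : cube_closed (fun a x b y => G (p (h a)) (p (h x)) (p (h b)) (p (h y))).
  apply: testS => [|c cS].
    by have [swp trp col] := square_bit_symmetric g; split=> *;
      [exact: swp | exact: trp | exact: col].
  have inj_c := injS c cS.
  pose C : cube V := exist (@is_cube V) _ (cube_graph_is_cube (inj_hc c inj_c)).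
  have CS : C \in [set C : cube V | [exists c in S, val C == cube_graph [ffun k => h (c k)]]].
    by rewrite inE; apply/exists_inP; exists c.
  have := no_bad C CS; rewrite negbK.
  have EC : val (act_cube p C) = cube_graph [ffun k => p ([ffun l => h (c l)] k)].
    exact: act_cube_graph.
  rewrite (delta2E g_mu (act_corners_inj (inj_hc c inj_c)) EC).
  rewrite (@eq_cube_sum _ _ (fun a x b y => G (p (h a)) (p (h x)) (p (h b)) (p (h y))) G
    (fun i => p (h i)) c [ffun k => p ([ffun l => h (c l)] k)]) //; last by move=> k;
      rewrite !ffunE.
  by case: cube_sum.
have pull z : z \in [:: u; v; w; s; t; a; x; b; y] -> exists i, h i = z := cover z.
have [iu Eu] := pull u ltac:(by rewrite !inE eqxx).
have [iv Ev] := pull v ltac:(by rewrite !inE eqxx ?orbT).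
have [iw Ew] := pull w ltac:(by rewrite !inE eqxx ?orbT).
have [i_s Es] := pull s ltac:(by rewrite !inE eqxx ?orbT).
have [i_t Et] := pull t ltac:(by rewrite !inE eqxx ?orbT).
have [ia Ea] := pull a ltac:(by rewrite !inE eqxx ?orbT).
have [ix Ex] := pull x ltac:(by rewrite !inE eqxx ?orbT).
have [ib Eb] := pull b ltac:(by rewrite !inE eqxx ?orbT).
have [iy Ey] := pull y ltac:(by rewrite !inE eqxx ?orbT).
have antiL (k l : V) : k != l -> (k < l)%O = ~~ (l < k)%O.
  by move=> ne_kl; rewrite -leNgt lt_neqAle ne_kl.
have Eq' : val (act_square p q) = cycle4 (p a) (p x) (p b) (p y) by rewrite /= Eq act_cycle4.
have D' : uniq [:: p a; p x; p b; p y].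
  by rewrite (map_inj_uniq (@perm_inj _ p) [:: a; x; b; y]).
rewrite /bad_square /= negbK (square_bitE g_mu D' Eq') (model_cochainE _ _ _ _ _ D' Eq').
rewrite -Eu -Ev -Ew -Es -Et -Ea -Ex -Eb -Ey.
have card_9 : (8 < #|'I_9|)%N by rewrite card_ord.
have base9 : uniq [:: iu; iv; iw; i_s; i_t].
  by rewrite -(map_inj_uniq inj_h) /= Eu Ev Ew Es Et.
have square9 : uniq [:: ia; ix; ib; iy].
  by rewrite -(map_inj_uniq inj_h) /= Ea Ex Eb Ey.
have symG := square_bit_symmetric g.
have E := closed_model ph_inj card_9 symG closed antiL base9 square9.
by apply/eqP; congr (_ ^+ nat_of_bool _); exact: E.
Qed.

(** First moment: for each [q], a union bound over the tested cubes and [cube_average] bound the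
    permutations with bad image of [q]; some permutation then does no worse than the mean. *)
Lemma few_bad_squares : (8 < #|V|)%N ->
  exists p, (#|bad_square p| * #|{: cube V}| <= 1296 * #|{: square V}| * #|bad_cube|)%N.
Proof.
move=> card_V.
have bound q : (#|[set p : {perm V} | bad_square p (act_square p q)]| * #|{: cube V}|
    <= 1296 * #|bad_cube| * #|{: {perm V}}|)%N.
  have [S [leS witS]] := bad_square_witness q card_V.
  apply: leq_trans (_ : (\sum_(C in S) #|[set p : {perm V} | bad_cube (act_cube p C)]|)
    * #|{: cube V}| <= _)%N.
    rewrite leq_mul2r; apply/orP; right.
    rewrite card_setE (eq_bigr _ (fun C _ => card_setE (fun p => bad_cube (act_cube p C)))).
    rewrite exchange_big /=; apply: leq_sum => p _.
    case: (boolP (bad_square _ _)) => // /witS[C CS bC].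
    by rewrite (bigD1 C) //= bC.
  rewrite big_distrl /= (eq_bigr _ (fun C _ => cube_average bad_cube C)) sum_nat_const.
  by rewrite mulnA !leq_mul2r leS !orbT.
have total : ((\sum_(p : {perm V}) #|bad_square p|) * #|{: cube V}|
    <= \sum_(p : {perm V}) 1296 * #|{: square V}| * #|bad_cube|)%N.
  (* For fixed [p], the map [act_square p] permutes the squares, so squares with bad image are as
     many as bad squares. *)
  have -> : (\sum_(p : {perm V}) #|bad_square p| =
      \sum_q #|[set p : {perm V} | bad_square p (act_square p q)]|)%N.
    rewrite (eq_bigr _ (fun q _ => card_setE (fun p => bad_square p (act_square p q)))).
    rewrite exchange_big; apply: eq_bigr => p _.
    by rewrite card_predE (reindex_inj (@act_square_inj _ p)).
  rewrite big_distrl /= sum_nat_const.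
  apply: leq_trans (leq_sum _ (fun q _ => bound q)) _.
  by rewrite sum_nat_const mulnA [leqRHS]mulnC mulnA (mulnC 1296%N).
(* If every permutation exceeded the mean, so would the sum, the group being nonempty. *)
apply/existsP; apply: contraLR total => /existsPn no_p; rewrite -ltnNge big_distrl /=.
have lt_p p : (1296 * #|{: square V}| * #|bad_cube| < #|bad_square p| * #|{: cube V}|)%N.
  by rewrite ltnNge no_p.
apply: leq_trans (leq_sum _ (fun p _ => lt_p p)).
by rewrite !sum_nat_const ltn_pmul2l //; apply/card_gt0P; exists 1%g.
Qed.

End Stability.

(** * From counts to probabilities *)

Theorem theorem9p2 (R : realType) :
  exists r : R, r < 1504 /\
    forall (d : Order.disp_t) (V : finOrderType d) (p : R)
           (g : {ffun square V -> int}),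
      (8 < #|V|)%N ->
      0 < p ->
      g \in cochain (square V) ->
      sim p (delta2 g) [ffun _ => 1] ->
      exists (theta pi : int) (f : {ffun edge V -> int}),
        [/\ theta \in mu2, pi \in mu2, f \in cochain (edge V) &
            sim (r * p) g
              [ffun q : square V => theta * order_cochain V pi q * delta1 f q]].
Proof.
exists 1296%:R; split; first by rewrite ltr_nat.
move=> d V p g card_V _ g_mu; rewrite /sim /disagreement => sim_g.
have sign_mu (b : bool) : (-1) ^+ b \in mu2 by case: b.
(* Nine distinct vertices of [V]: the first five serve as the base, and eight of them give a
   cube. *)
have [h inj_h _] : exists2 h : 'I_9 -> V, injective h & forall z, z \in [::] -> exists i, h i = z.
  have /card_gt0P[z0 _] : (0 < #|V|)%N by exact: leq_trans card_V.
  exact: (@nine_points V z0 [::]).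
pose b k : V := h (inord k).
have uniq_b : uniq [:: b 0%N; b 1%N; b 2%N; b 3%N; b 4%N].
  rewrite (map_inj_in_uniq (s := [:: 0; 1; 2; 3; 4]%N)) //
    => k l k_lt l_lt /inj_h /(congr1 (@nat_of_ord 9)).
  rewrite !inordK //; first by move: l_lt; rewrite !inE => /or4P[|||/orP[]] /eqP ->.
  by move: k_lt; rewrite !inE => /or4P[|||/orP[]] /eqP ->.
have [s leq_s] := few_bad_squares g_mu uniq_b card_V.
exists (theta_sign g (s (b 0%N)) (s (b 1%N)) (s (b 2%N)) (s (b 3%N))).
exists (pi_sign g (s (b 0%N)) (s (b 1%N)) (s (b 2%N)) (s (b 3%N)) (s (b 4%N))).
exists (potential_cochain g (s (b 0%N)) (s (b 1%N)) (s (b 2%N)) (s (b 3%N)) (s (b 4%N))).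
split; [exact: sign_mu | exact: sign_mu | by apply/ffun_onP=> e; rewrite ffunE sign_mu | ].
(* The disagreements are quotients by the numbers of cubes and of squares, which must be positive to
   clear denominators. *)
have cube_gt0 : (0 < #|{: cube V}|)%N.
  have card_corner : #|corner| = 8%N by rewrite card_ffun card_ord card_bool.
  have inj_c : injective [ffun k : corner => h (inord (enum_rank k))].
    move=> k l; rewrite !ffunE => /inj_h /(congr1 (@nat_of_ord 9)).
    have lt9 (m : corner) : (enum_rank m < 9)%N.
      by rewrite (leq_trans (ltn_ord _)) // card_corner.
    by rewrite !inordK // => /val_inj /enum_rank_inj.
  by apply/card_gt0P; exists (exist (@is_cube V) _ (cube_graph_is_cube inj_c)).
have square_gt0 : (0 < #|{: square V}|)%N.
  have D : uniq [:: b 0%N; b 1%N; b 2%N; b 3%N] by distinct.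
  by apply/card_gt0P; exists (exist (@is_square V) _ (cycle4_is_square D)).
move: sim_g; have -> : #|[set C : cube V | delta2 g C != [ffun=> 1] C]| = #|bad_cube g|.
  by apply: eq_card => C; rewrite inE (ffunE (fun _ => 1)).
rewrite ler_pdivrMr ?ltr0n // => sim_g; rewrite ler_pdivrMr ?ltr0n //.
set N := #|_|; have -> : N = #|bad_square g (b 0%N) (b 1%N) (b 2%N) (b 3%N) (b 4%N) s|.
  by apply: eq_card => q; rewrite inE.
have Q_gt0 : 0 < #|{: cube V}|%:R :> R by rewrite ltr0n.
rewrite -(ler_pM2r Q_gt0) -natrM (le_trans (_ : _ <= (1296 * #|{: square V}| *
  #|bad_cube g|)%:R)) ?ler_nat //.
rewrite !natrM -!mulrA ler_wpM2l ?ler0n // mulrCA.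
by rewrite ler_wpM2l ?ler0n.
Qed.
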